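(* Let $q$ be a prime power, let $1<k<n-1$, and let $V=F_q^n$. Let $U\subseteq V$ be a $(k+1)$-dimensional non-degenerate linear code with generator matrix $M$ (a $(k+1)\times n$ matrix whose rows form a basis of $U$). Let $W'\subseteq F_q^{k+1}$ be the set of all non-zero vectors not proportional to any column of $M$, and let $W$ be the subspace of $F_q^{k+1}$ spanned by $W'$. Let $\langle U]^c_k$ denote the set of all $k$-dimensional subspaces of $U$ that are non-degenerate linear codes. Then $\langle U]^c_k$ is contained in a line of $\mathcal G_k(V)$ if and only if $\dim W\leqslant 2$.
   Context: $F_q$ is the field with $q$ elements; $\mathcal G_k(V)$ is the set of all $k$-dimensional subspaces of $V$. For $i=1,\dots,n$, $C_i$ is the coordinate hyperplane $\{x\in V: x_i=0\}$. A subspace of $V$ is a non-degenerate linear code if it is not contained in any $C_i$. A line of $\mathcal G_k(V)$ is a set $[S,T]_k=\{K\in\mathcal G_k(V): S\subset K\subset T\}$ where $S\subset T$ are subspaces of $V$ with $\dim S=k-1$ and $\dim T=k+1$. *)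

(* Defs.v *)
From HB Require Import structures.
From mathcomp Require Import all_boot all_order all_algebra.

Set Implicit Arguments.
Unset Strict Implicit.
Unset Printing Implicit Defensive.

Import GRing.Theory.
Local Open Scope ring_scope.

(* The ambient space F_q^n is 'rV[F]_n for a finite field F with q elements. *)

Definition coord_hyperplane (F : finFieldType) (n : nat) (i : 'I_n) :
  {set 'rV[F]_n} := [set x : 'rV[F]_n | x 0 i == 0].

Definition nondegenerate_code (F : finFieldType) (n : nat)
  (U : {vspace 'rV[F]_n}) : bool :=
  [forall i : 'I_n, ~~ (U \subset coord_hyperplane F i)].

Definition grassmannian (F : finFieldType) (n k : nat) :
  {pred {vspace 'rV[F]_n}} := [pred K | \dim K == k].

Definition grass_interval (F : finFieldType) (n k : nat)
  (S T : {vspace 'rV[F]_n}) : {pred {vspace 'rV[F]_n}} :=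
  [pred K in grassmannian k | (S <= K)%VS && (K <= T)%VS].

Definition is_line (F : finFieldType) (n k : nat)
  (L : {pred {vspace 'rV[F]_n}}) : Prop :=
  exists S T : {vspace 'rV[F]_n},
    [/\ (S <= T)%VS, \dim S = (k - 1)%N, \dim T = (k + 1)%N
      & L =i grass_interval k S T].

Definition nondegenerate_subcodes (F : finFieldType) (n k : nat)
  (U : {vspace 'rV[F]_n}) : {pred {vspace 'rV[F]_n}} :=
  [pred K in grassmannian k | (K <= U)%VS && nondegenerate_code K].

Definition generator_matrix (F : finFieldType) (m n : nat)
  (U : {vspace 'rV[F]_n}) (M : 'M[F]_(m, n)) : bool :=
  basis_of U [seq row i M | i <- enum 'I_m].

Definition proportional (F : finFieldType) (m : nat) (u v : 'cV[F]_m) : bool :=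
  [exists a : F, (a != 0) && (u == a *: v)].

(* Vectors of F_q^m are written as columns, to be compared with those of M. *)
Definition noncolumn_vectors (F : finFieldType) (m n : nat)
  (M : 'M[F]_(m, n)) : {set 'cV[F]_m} :=
  [set w | (w != 0) && [forall j : 'I_n, ~~ proportional w (col j M)]].

Definition noncolumn_span (F : finFieldType) (m n : nat)
  (M : 'M[F]_(m, n)) : {vspace 'cV[F]_m} :=
  <<enum (noncolumn_vectors M)>>%VS.

(* Main.v *)
(* With [M] row free, [y |-> y *m M] identifies F^(k+1) with [U], and the
   hyperplanes of [U] are the kernels [y *m w = 0] of non-zero columns [w].  The
   hyperplane of [w] lies in [C_j] iff [w] is proportional to column [j] of [M],
   so the non-degenerate ones are those with [w] in [W'].  A subspace [S] of [U]
   lies in all of them iff [W] annihilates it, and this leaves room for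
   [\dim S = k - 1] exactly when [\dim W <= 2]. *)
Require Import Defs.
From mathcomp Require Import all_boot all_order all_algebra.

Import GRing.Theory.
Local Open Scope ring_scope.

(** * Coordinates on a code given by a generator matrix *)

Section GeneratorMatrix.
Context {F : finFieldType} {m n : nat} {U : {vspace 'rV[F]_n}}.
Context {M : 'M[F]_(m, n)} (hM : generator_matrix U M).

Lemma generator_matrixP x :
  reflect (exists y : 'rV_m, x = y *m M) (x \in U).
Proof.
have /span_basis defU := hM.
apply: (iffP idP) => [|[y ->]].
  suff /subvP sU : (U <= limg (linfun (mulmxr M : 'rV_m -> _)))%VS.
    by move=> /sU/memv_imgP[y _]; rewrite lfunE; exists y.
  rewrite -defU; apply/span_subvP => _ /mapP[i _ ->].
  apply/memv_imgP; exists (delta_mx 0 i); first exact: memvf.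
  by rewrite lfunE /= -rowE.
rewrite mulmx_sum_row memv_suml // => i _; apply: memvZ.
by rewrite -defU; apply/memv_span/mapP; exists i; rewrite ?mem_enum.
Qed.

Lemma generator_matrix_dim : \dim U = m.
Proof.
have := hM; rewrite /generator_matrix basisEdim => /andP[sU le_m].
apply/eqP; rewrite eqn_leq.
move: le_m; rewrite size_map size_enum_ord => ->; rewrite andbT.
apply: leq_trans (dimvS sU) (leq_trans (dim_span _) _).
by rewrite size_map size_enum_ord.
Qed.

(** Rank-nullity: the image of [y |-> y *m M] contains [U], of dimension [m], which leaves only the
    zero kernel. *)
Lemma generator_matrix_row_free : row_free M.
Proof.
pose f := linfun (mulmxr M : 'rV_m -> _).
have sU : (U <= limg f)%VS.
  apply/subvP => x /generator_matrixP[y ->].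
  by apply/memv_imgP; exists y; rewrite ?memvf ?lfunE.
have ker0 : lker f == 0%VS.
  rewrite -dimv_eq0 -leqn0 -(leq_add2r (\dim (limg f))).
  have := limg_ker_dim f fullv; rewrite capfv => ->.
  rewrite dimvf /dim /= mul1n add0n.
  by apply: leq_trans (dimvS sU); rewrite generator_matrix_dim.
apply: inj_row_free => v vM0; apply/eqP; rewrite -memv0 -(eqP ker0).
by rewrite memv_ker lfunE /= vM0.
Qed.

Lemma generator_matrixK x : x \in U -> x *m pinvmx M *m M = x.
Proof.
move=> /generator_matrixP[y ->].
by rewrite mulmxKp ?generator_matrix_row_free.
Qed.

(** On [U], [pinvmx M] recovers the coordinates [y] of [y *m M], so these are the codewords with
    [y *m B = 0]. One column gives a hyperplane kernel, several give an intersection of such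
    kernels. *)
Definition subcode {p} (B : 'M[F]_(m, p)) : {vspace 'rV[F]_n} :=
  (U :&: lker (linfun (mulmxr (pinvmx M *m B) : 'rV_n -> 'rV_p)))%VS.

Lemma mem_subcode p (B : 'M[F]_(m, p)) x :
  (x \in subcode B) = (x \in U) && (x *m pinvmx M *m B == 0).
Proof. by rewrite memv_cap memv_ker lfunE /= mulmxA. Qed.

Lemma mem_subcode_mul p (B : 'M[F]_(m, p)) (y : 'rV_m) :
  (y *m M \in subcode B) = (y *m B == 0).
Proof.
rewrite mem_subcode mulmxKp ?generator_matrix_row_free //.
by have /generator_matrixP-> : exists z, y *m M = z *m M by exists y.
Qed.

(** Each of the [p] columns imposes at most one independent linear condition. *)
Lemma dim_subcode_ge p (B : 'M[F]_(m, p)) : (m - p <= \dim (subcode B))%N.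
Proof.
rewrite leq_subLR -[m in (m <= _)%N]generator_matrix_dim.
rewrite -(limg_ker_dim (linfun (mulmxr (pinvmx M *m B) : 'rV_n -> 'rV_p)) U).
rewrite addnC leq_add2r (leq_trans (dimvS (subvf _))) //.
by rewrite dimvf /dim /= mul1n.
Qed.

(** One condition costs at most one dimension; if it cost none, every unit vector would annihilate
    [w], forcing [w = 0]. *)
Lemma dim_subcode_col (w : 'cV[F]_m) : w != 0 -> \dim (subcode w) = m.-1.
Proof.
move=> w0; apply/eqP; rewrite eqn_leq -{2}subn1 dim_subcode_ge andbT.
have m_gt0 : (0 < m)%N by move: w0; case: (m) w => // w; rewrite [w]flatmx0 eqxx.
rewrite -ltnS prednK // -generator_matrix_dim ltn_neqAle dimvS ?capvSl // andbT.
apply: contra w0 => /eqP eq_dim.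
have /eqP eqU : subcode w == U by rewrite eqEdim capvSl eq_dim /=.
apply/eqP/row_matrixP => i; rewrite row0 rowE; apply/eqP.
rewrite -mem_subcode_mul eqU.
by apply/generator_matrixP; exists (delta_mx 0 i).
Qed.

End GeneratorMatrix.

Arguments subcode {F m n} U M {p} B.

(** * Bases, annihilators and proportional columns *)

Lemma generator_matrix_exists (F : finFieldType) n (S : {vspace 'rV[F]_n}) :
  exists A : 'M[F]_(\dim S, n), generator_matrix S A.
Proof.
exists (\matrix_i (vbasis S)`_i); rewrite /generator_matrix.
rewrite (_ : map _ _ = vbasis S) ?vbasisP // -[RHS]map_tnth_enum.
by apply: eq_map => i; rewrite rowK -tnth_nth.
Qed.

Lemma col_combination (F : fieldType) m (W : {vspace 'cV[F]_m}) :
  exists B : 'M[F]_(m, \dim W), forall w, w \in W -> exists c, w = B *m c.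
Proof.
exists (\matrix_(i, j) (vbasis W)`_j i 0) => w /coord_vbasis ->.
exists (\col_j coord (vbasis W) j w); apply/matrixP => i j.
rewrite summxE !mxE; apply: eq_bigr => l _.
by rewrite !mxE (ord1 j) mulrC.
Qed.

Lemma dim_orthogonal (F : fieldType) p m (A : 'M[F]_(p, m)) :
  row_free A ->
  \dim (lker (linfun (mulmx A : 'cV_m -> 'cV_p))) = (m - p)%N.
Proof.
move=> fA; set f := linfun _.
have fullf : limg f = fullv.
  apply/vspaceP => z; rewrite memvf.
  apply/memv_imgP; exists (pinvmx A *m z); first exact: memvf.
  by rewrite lfunE /= mulmxA mulmxVp // mul1mx.
have := limg_ker_dim f fullv.
rewrite capfv fullf !dimvf /dim /= !muln1 => dim_m.
by rewrite -[in RHS]dim_m addnK.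
Qed.

Lemma subvs_dim_exists (F : fieldType) (vT : vectType F) (V : {vspace vT}) d :
  (d <= \dim V)%N -> exists2 S : {vspace vT}, (S <= V)%VS & \dim S = d.
Proof.
move=> le_d; exists <<take d (vbasis V)>>%VS.
  by apply/span_subvP => x /mem_take; apply: vbasis_mem.
have /basis_free : basis_of V (vbasis V) := vbasisP V.
rewrite -{1}(cat_take_drop d (vbasis V)) => /catl_free/eqP->.
by rewrite size_takel // size_tuple.
Qed.

Lemma proportional_of_ker (F : finFieldType) m (w c : 'cV[F]_m) :
  w != 0 -> c != 0 -> (forall y : 'rV_m, y *m w = 0 -> y *m c = 0) ->
  proportional w c.
Proof.
move=> w0 c0 sub_ker.
have [i wi] : exists i, w i 0 != 0.
  apply/existsP; apply: contraR w0 => /existsPn w0.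
  by apply/eqP/colP => i; rewrite mxE; apply/eqP; rewrite -[_ == _]negbK.
have mul_delta (v : 'cV[F]_m) l : (delta_mx 0 l : 'rV_m) *m v = (v l 0)%:M.
  by rewrite -rowE; apply/matrixP => a b; rewrite !mxE !ord1.
have wc l : w i 0 * c l 0 = w l 0 * c i 0.
  (* This vector annihilates [w]; that it also annihilates [c] is the vanishing of a 2 by 2 minor of
     the pair [w], [c]. *)
  have := sub_ker (w i 0 *: delta_mx 0 l - w l 0 *: delta_mx 0 i).
  rewrite !mulmxBl -!scalemxAl !mul_delta !scale_scalar_mx mulrC subrr.
  by move=> /(_ erefl)/eqP; rewrite subr_eq0 =>
    /eqP/matrixP/(_ 0 0); rewrite !mxE.
have ci : c i 0 != 0.
  apply: contra c0 => /eqP ci0; apply/eqP/colP => l; rewrite mxE.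
  by apply/(mulfI wi); rewrite wc ci0 !mulr0.
apply/existsP; exists (w i 0 / c i 0); rewrite mulf_neq0 ?invr_eq0 //=.
by apply/eqP/colP => l; rewrite mxE mulrAC wc mulfK.
Qed.

(** * Non-degenerate hyperplanes of a code *)

Section NondegenerateSubcodes.
Context {F : finFieldType} {m n : nat} {U : {vspace 'rV[F]_n}}.
Context {M : 'M[F]_(m, n)} (hM : generator_matrix U M).

Lemma mulmx_col_entry (y : 'rV[F]_m) j : (y *m M) 0 j = (y *m col j M) 0 0.
Proof. by rewrite !mxE; apply: eq_bigr => l _; rewrite !mxE. Qed.

Lemma col_generator_neq0 j : nondegenerate_code U -> col j M != 0.
Proof.
move=> /forallP/(_ j); apply: contra => /eqP cj0; apply/subsetP => x.
move=> /(generator_matrixP hM)[y ->].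
by rewrite inE mulmx_col_entry cj0 mulmx0 mxE.
Qed.

Lemma noncolumn_subcode_nondegenerate w : nondegenerate_code U ->
  w \in noncolumn_vectors M -> nondegenerate_code (subcode U M w).
Proof.
move=> ndU; rewrite inE => /andP[w0 /forallP npw].
apply/forallP => j; apply: contra (npw j) => /subsetP sub.
apply: proportional_of_ker => // [|y yw0]; first exact: col_generator_neq0.
have := sub (y *m M); rewrite (mem_subcode_mul hM) yw0 eqxx => /(_ isT).
rewrite inE mulmx_col_entry => /eqP y0.
by apply/matrixP => a b; rewrite !ord1 y0 mxE.
Qed.

(** [O] is the annihilator of the coordinate vectors of [S]. Since it is a subspace, a containment
    known for all [w] in a set extends to the span of that set. *)
Lemma subcode_orthogonal (S : {vspace 'rV[F]_n}) : (S <= U)%VS ->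
  exists2 O : {vspace 'cV[F]_m}, \dim O = (m - \dim S)%N
    & forall w, (w \in O) = (S <= subcode U M w)%VS.
Proof.
move=> sSU; have [B hB] := generator_matrix_exists _ _ S.
have BK : B *m pinvmx M *m M = B.
  apply/row_matrixP => i; rewrite !row_mul (generator_matrixK hM) //.
  apply: (subvP sSU); apply/(generator_matrixP hB).
  by exists (delta_mx 0 i); rewrite -rowE.
(* The coordinate rows inherit independence from [B], which they give back after multiplication by
   [M]. *)
have fA : row_free (B *m pinvmx M).
  apply: inj_row_free => v v0.
  apply: (row_free_inj (generator_matrix_row_free hB)).
  by rewrite mul0mx -BK mulmxA v0 mul0mx.
exists (lker (linfun (mulmx (B *m pinvmx M) : 'cV_m -> _))).
  exact: dim_orthogonal.
move=> w; rewrite memv_ker lfunE /=; apply/eqP/subvP => [w0 x xS|sub].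
  rewrite mem_subcode // (subvP sSU) //=.
  have /(generator_matrixP hB)[y ->] := xS.
  by apply/eqP; rewrite -[y *m B *m _]mulmxA -[LHS]mulmxA w0 mulmx0.
apply/row_matrixP => i; rewrite row0 !row_mul; apply/eqP.
have: row i B \in S.
  by apply/(generator_matrixP hB); exists (delta_mx 0 i); rewrite -rowE.
by move/sub; rewrite mem_subcode // => /andP[].
Qed.

(** The annihilator of [K] has dimension 1; any non-zero [w] in it cuts out a hyperplane containing
    [K], equal to [K] by dimension. *)
Lemma nondegenerate_hyperplaneP (K : {vspace 'rV[F]_n}) :
  (K <= U)%VS -> (\dim K).+1 = m -> nondegenerate_code K ->
  exists2 w, w \in noncolumn_vectors M & K = subcode U M w.
Proof.
move=> sKU dimK /forallP ndK.
have [O dimO memO] := subcode_orthogonal K sKU.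
have O0 : O != 0%VS by rewrite -dimv_eq0 dimO -dimK subSnn.
have w0 : vpick O != 0 by rewrite vpick0.
have sKw : (K <= subcode U M (vpick O))%VS by rewrite -memO memv_pick.
exists (vpick O); last first.
  by apply/eqP; rewrite eqEdim sKw (dim_subcode_col hM) // -dimK /=.
rewrite inE w0 /=; apply/forallP => j; apply: contra (ndK j).
move=> /existsP[a /andP[_ /eqP defw]]; apply/subsetP => x /(subvP sKw).
rewrite mem_subcode // => /andP[xU].
rewrite defw -scalemxAr scalemx_eq0 => /orP[/eqP a0|/eqP x0].
  by move: w0; rewrite defw a0 scale0r eqxx.
by rewrite inE -(generator_matrixK hM _ xU) mulmx_col_entry x0 mxE.
Qed.

End NondegenerateSubcodes.

Theorem theorem1 (F : finFieldType) (n k : nat) (hk : (1 < k < n - 1)%N)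
    (U : {vspace 'rV[F]_n}) (dimU : \dim U = (k + 1)%N)
    (ndU : nondegenerate_code U)
    (M : 'M[F]_(k + 1, n)) (hM : generator_matrix U M) :
  (exists L : {pred {vspace 'rV[F]_n}},
      is_line k L /\ {subset nondegenerate_subcodes k U <= L})
  <-> (\dim (noncolumn_span M) <= 2)%N.
Proof.
split=> [[L [[S [T [_ dimS _ defL]]] subL]]|dimW].
  have S_le w : w \in noncolumn_vectors M -> (S <= subcode U M w)%VS.
    move=> wW; have : subcode U M w \in nondegenerate_subcodes k U.
      rewrite !inE capvSl (noncolumn_subcode_nondegenerate hM) // !andbT.
      have := wW; rewrite [w \in _]inE => /andP[w0 _].
      by rewrite (dim_subcode_col hM) // addn1.
    by move=> /subL; rewrite defL !inE => /and3P[].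
  (* A member of the set is what places [S] inside [U]; if there is none, the span is zero. *)
  have [W0|[w wW]] := set_0Vmem (noncolumn_vectors M).
    by rewrite /noncolumn_span W0 enum_set0 span_nil dimv0.
  have [O dimO memO] := subcode_orthogonal hM S
    (subv_trans (S_le w wW) (capvSl _ _)).
  (* The codimension of [S] in [U] is [(k + 1) - (k - 1)], and the truncated [k - 1] is exact since
     [k] is positive. *)
  have -> : 2%N = \dim O.
    by rewrite dimO dimS; case: (k) hk => // k' _;
      rewrite subn1 addn1 subSn // subSnn.
  by apply/dimvS/span_subvP => v; rewrite mem_enum memO; apply: S_le.
have [B hB] := col_combination _ _ (noncolumn_span M).
(* The columns of [B] span the noncolumn span and number at most 2, so their common kernel in [U]
   has dimension at least [(k + 1) - 2]. *)
have [|S sSB dimS] := subvs_dim_exists _ _ (subcode U M B) (k - 1).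
  apply: leq_trans (dim_subcode_ge hM _ B).
  by rewrite -(subnDr 1 k 1) leq_sub2l.
exists (grass_interval k S U); split.
  by exists S, U; split=> //; apply: subv_trans sSB (capvSl _ _).
move=> K; rewrite !inE => /and3P[dimK sKU ndK].
rewrite dimK sKU andbT /=.
have [|w wW ->] := nondegenerate_hyperplaneP hM K sKU _ ndK.
  by rewrite (eqP dimK) addn1.
apply/(subv_trans sSB)/subvP => x; rewrite !mem_subcode // => /andP[-> /eqP xB].
(* As [w] is a combination of the columns of [B], whatever annihilates [B] annihilates [w]. *)
have [|c ->] := hB w; first by rewrite memv_span // mem_enum.
by rewrite mulmxA xB mul0mx eqxx.
Qed.
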